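(* Let $T:V\to L$ be a relative Rota-Baxter operator on a (right) Leibniz algebra $(L,[\cdot,\cdot]_L)$ with respect to a representation $(V;\rho^l,\rho^r)$. Every $1$-cocycle for the cohomology of the Leibniz algebra $(V,[\cdot,\cdot]_T)$ with respect to the representation $(L;\rho^l_T,\rho^r_T)$ is a $1$-cocycle for the cohomology of the Leibniz triple system $(V,\{\cdot,\cdot,\cdot\}_T=[[\cdot,\cdot]_T,\cdot]_T)$ with respect to the representation $(R_T,M_T,L_T)$ on $L$.
   Context: All vector spaces are over a fixed arbitrary field. A (right) Leibniz algebra is a vector space $L$ with a bilinear bracket satisfying $[x,[y,z]_L]_L=[[x,y]_L,z]_L-[[x,z]_L,y]_L$. A representation $(V;\rho^l,\rho^r)$ of $L$ consists of a vector space $V$ and linear maps $\rho^l,\rho^r:L\to\mathfrak{gl}(V)$ with, for all $x,y\in L$: $\rho^l([x,y]_L)=\rho^r(y)\rho^l(x)-\rho^l(x)\rho^r(y)$, $\rho^l([x,y]_L)=\rho^l(x)\rho^l(y)+\rho^r(y)\rho^l(x)$, $\rho^r([x,y]_L)=\rho^r(y)\rho^r(x)-\rho^r(x)\rho^r(y)$. A relative Rota-Baxter operator on $L$ with respect to $(V;\rho^l,\rho^r)$ is a linear map $T:V\to L$ with $[Tu,Tv]_L=T(\rho^l(Tu)v+\rho^r(Tv)u)$ for all $u,v\in V$. Then $V$ is a Leibniz algebra with $[u,v]_T=\rho^l(Tu)v+\rho^r(Tv)u$, with a representation $(L;\rho^l_T,\rho^r_T)$ given by $\rho^l_T(u)x=[Tu,x]_L-T\rho^r(x)u$,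 $\rho^r_T(u)x=[x,Tu]_L-T\rho^l(x)u$ ($u\in V$, $x\in L$). A $1$-cocycle of the Leibniz algebra $(V,[\cdot,\cdot]_T)$ with respect to $(L;\rho^l_T,\rho^r_T)$ is a linear map $\phi:V\to L$ with $\rho^l_T(u)\phi(v)+\rho^r_T(v)\phi(u)-\phi([u,v]_T)=0$ for all $u,v\in V$. $(V,\{\cdot,\cdot,\cdot\}_T)$ with $\{u,v,w\}_T=[[u,v]_T,w]_T$ is a Leibniz triple system, with representation $(R_T,M_T,L_T)$ on $L$, where $R_T(u,v)x=\rho^r_T(v)\rho^r_T(u)x$, $M_T(u,v)x=\rho^r_T(v)\rho^l_T(u)x$, $L_T(u,v)x=\rho^l_T([u,v]_T)x$. (A Leibniz triple system is a vector space with a trilinear product satisfying $\{a,b,\{c,d,e\}\}=\{\{a,b,c\},d,e\}-\{\{a,b,d\},c,e\}-\{\{a,b,e\},c,d\}+\{\{a,b,e\},d,c\}$ and $\{a,\{b,c,d\},e\}=\{\{a,b,c\},d,e\}-\{\{a,c,b\},d,e\}-\{\{a,d,b\},c,e\}+\{\{a,d,c\},b,e\}$; a triple $(r,m,l)$ of bilinear maps from it to $\mathrm{End}(W)$ is a representation on $W$ iff the direct sum with product $\{x+u,y+v,z+w\}=\{x,y,z\}+l(x,y)w+m(x,z)v+r(y,z)u$ is again a Leibniz triple system.) A $1$-cocycle of the Leibniz triple system $(V,\{\cdot,\cdot,\cdot\}_T)$ with respect to $(R_T,M_T,L_T)$ is a linear map $\phi:V\to L$ with $\partial^1\phi=0$,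 where $\partial^1\phi(u,v,w)=R_T(v,w)\phi(u)+M_T(u,w)\phi(v)+L_T(u,v)\phi(w)-\phi(\{u,v,w\}_T)$. *)

(* Defs.v *)
From HB Require Import structures.
From mathcomp Require Import all_boot all_order all_algebra.

Set Implicit Arguments.
Unset Strict Implicit.
Unset Printing Implicit Defensive.

Import GRing.Theory.
Local Open Scope ring_scope.

(* Algebraic structures are records over a fixed carrier, not canonical
   structures: the same space [V] carries several brackets. *)

Record leibnizAlgebra (K : fieldType) (L : lmodType K) := LeibnizAlgebra {
  lbr :> {bilinear L -> L -> L};
  lbr_leibniz : forall x y z : L,
    lbr x (lbr y z) = lbr (lbr x y) z - lbr (lbr x z) y }.

(* A linear map [L -> gl(V)] is encoded as a bilinear map [L -> V -> V]. *)
Record leibnizRep (K : fieldType) (L : lmodType K) (A : leibnizAlgebra L)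
    (V : lmodType K) := LeibnizRep {
  rhol : {bilinear L -> V -> V};
  rhor : {bilinear L -> V -> V};
  rhol_br : forall (x y : L) (v : V),
    rhol (A x y) v = rhor y (rhol x v) - rhol x (rhor y v);
  rhol_br' : forall (x y : L) (v : V),
    rhol (A x y) v = rhol x (rhol y v) + rhor y (rhol x v);
  rhor_br : forall (x y : L) (v : V),
    rhor (A x y) v = rhor y (rhor x v) - rhor x (rhor y v) }.

Definition leibniz_cocycle1 (K : fieldType) (L W : lmodType K)
    (A : leibnizAlgebra L) (rho : leibnizRep A W) (phi : {linear L -> W}) :=
  forall u v : L,
    rhol rho u (phi v) + rhor rho v (phi u) - phi (A u v) = 0.

Definition trilinear (K : fieldType) (U1 U2 U3 W : lmodType K)
    (f : U1 -> U2 -> U3 -> W) : Prop :=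
  [/\ forall y z, linear (fun x => f x y z),
      forall x z, linear (fun y => f x y z)
    & forall x y, linear (f x y)].

Definition leibniz_triple_axioms (K : fieldType) (V : lmodType K)
    (f : V -> V -> V -> V) : Prop :=
  [/\ trilinear f,
      forall a b c d e : V,
        f a b (f c d e) =
        f (f a b c) d e - f (f a b d) c e
        - f (f a b e) c d + f (f a b e) d c
    & forall a b c d e : V,
        f a (f b c d) e =
        f (f a b c) d e - f (f a c b) d e
        - f (f a d b) c e + f (f a d c) b e].

Record leibnizTriple (K : fieldType) (V : lmodType K) := LeibnizTriple {
  tpr :> V -> V -> V -> V;
  tprP : leibniz_triple_axioms tpr }.

Definition semidirect_triple (K : fieldType) (V W : lmodType K)
    (f : V -> V -> V -> V) (r m l : V -> V -> W -> W) (p q s : V * W) : V * W :=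
  (f p.1 q.1 s.1, l p.1 q.1 s.2 + m p.1 s.1 q.2 + r q.1 s.1 p.2).

Record leibnizTripleRep (K : fieldType) (V : lmodType K) (t : leibnizTriple V)
    (W : lmodType K) := LeibnizTripleRep {
  trR : V -> V -> W -> W;
  trM : V -> V -> W -> W;
  trL : V -> V -> W -> W;
  trR_lin : trilinear trR;
  trM_lin : trilinear trM;
  trL_lin : trilinear trL;
  trP : leibniz_triple_axioms (semidirect_triple t trR trM trL) }.

Definition triple_coboundary1 (K : fieldType) (V W : lmodType K)
    (t : leibnizTriple V) (th : leibnizTripleRep t W) (phi : V -> W)
    (u v w : V) : W :=
  trR th v w (phi u) + trM th u w (phi v) + trL th u v (phi w)
  - phi (t u v w).

Definition triple_cocycle1 (K : fieldType) (V W : lmodType K)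
    (t : leibnizTriple V) (th : leibnizTripleRep t W)
    (phi : {linear V -> W}) :=
  forall u v w : V, triple_coboundary1 th phi u v w = 0.

(* Equality of two signed sums of atoms in an abelian group. *)
Ltac abel :=
  apply/eqP; rewrite -subr_eq0; apply/eqP; rewrite -[LHS]add0r;
  rewrite ?(opprD, opprK, addrA) ?(opprD, opprK, addrA);
  repeat match goal with |- context [- ?x] =>
    rewrite ?(addrAC _ _ (- x)) ?(addrAC _ _ x) addrK end;
  try reflexivity.

Lemma leibniz_tripleP (K : fieldType) (L : lmodType K) (A : leibnizAlgebra L) :
  leibniz_triple_axioms (fun x y z => A (A x y) z).
Proof.
split.
- by split=> x y a u v /=; rewrite ?linearPl ?linearPr ?linearPl.
- move=> a b c d e; rewrite !lbr_leibniz linearBl opprB !addrA.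
  by rewrite -!addrA; congr (_ + (_ + _)); rewrite addrC.
move=> a b c d e; rewrite !lbr_leibniz !linearBl opprB /= !addrA.
by rewrite -!addrA; congr (_ + (_ + _)); rewrite addrC.
Qed.

Definition leibniz_triple (K : fieldType) (L : lmodType K)
    (A : leibnizAlgebra L) : leibnizTriple L :=
  LeibnizTriple (leibniz_tripleP A).

Definition semidirect_br (K : fieldType) (L W : lmodType K)
    (A : leibnizAlgebra L) (rho : leibnizRep A W) (p q : L * W) : L * W :=
  (A p.1 q.1, rhol rho p.1 q.2 + rhor rho q.1 p.2).

Lemma semidirect_br_bilinear (K : fieldType) (L W : lmodType K)
    (A : leibnizAlgebra L) (rho : leibnizRep A W) :
  bilinear_for *:%R *:%R (semidirect_br rho).
Proof.
split=> [[y w]|[y w]] a [x u] [x' u']; congr (_, _);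
  by rewrite /= ?linearPl ?linearPr // scalerDr addrACA.
Qed.

HB.instance Definition _ (K : fieldType) (L W : lmodType K)
    (A : leibnizAlgebra L) (rho : leibnizRep A W) :=
  bilinear_isBilinear.Build K (L * W)%type (L * W)%type (L * W)%type _ _
    (semidirect_br rho) (semidirect_br_bilinear rho).

Lemma semidirect_br_leibniz (K : fieldType) (L W : lmodType K)
    (A : leibnizAlgebra L) (rho : leibnizRep A W) (x y z : L * W) :
  semidirect_br rho x (semidirect_br rho y z) =
  semidirect_br rho (semidirect_br rho x y) z
  - semidirect_br rho (semidirect_br rho x z) y.
Proof.
case: x y z => [x u] [y v] [z w]; congr (_, _); rewrite /= ?lbr_leibniz //.
have hl : rhol rho x (rhol rho y w) =
    rhol rho (A x y) w - rhor rho y (rhol rho x w).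
  by rewrite rhol_br' addrK.
have hr : rhol rho x (rhor rho z v) =
    rhor rho z (rhol rho x v) - rhol rho (A x z) v.
  by rewrite rhol_br subKr.
rewrite !linearDr /= hl hr rhor_br.
abel.
Qed.

Definition semidirect (K : fieldType) (L W : lmodType K)
    (A : leibnizAlgebra L) (rho : leibnizRep A W) :
    leibnizAlgebra (L * W)%type :=
  @LeibnizAlgebra K (L * W)%type (semidirect_br rho)
    (semidirect_br_leibniz rho).

Section TripleRep.
Context (K : fieldType) (L W : lmodType K).
Context (A : leibnizAlgebra L) (rho : leibnizRep A W).

Definition triple_R (u v : L) (x : W) : W := rhor rho v (rhor rho u x).
Definition triple_M (u v : L) (x : W) : W := rhor rho v (rhol rho u x).
Definition triple_L (u v : L) (x : W) : W := rhol rho (A u v) x.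

Lemma triple_repR_lin : trilinear triple_R.
Proof.
by split=> x y a u v; rewrite /triple_R /= ?linearPl ?linearPr ?linearPl.
Qed.

Lemma triple_repM_lin : trilinear triple_M.
Proof.
by split=> x y a u v; rewrite /triple_M /= ?linearPl ?linearPr ?linearPl.
Qed.

Lemma triple_repL_lin : trilinear triple_L.
Proof.
by split=> x y a u v; rewrite /triple_L /= ?linearPl ?linearPr ?linearPl.
Qed.

Lemma semidirect_tripleE (p q s : L * W) :
  semidirect_triple (leibniz_triple A) triple_R triple_M triple_L p q s =
  semidirect rho (semidirect rho p q) s.
Proof.
by congr (_, _); rewrite /triple_R /triple_M /triple_L /= linearDr addrA.
Qed.

Lemma triple_repP :
  leibniz_triple_axioms
    (semidirect_triple (leibniz_triple A) triple_R triple_M triple_L).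
Proof.
have [[h1 h2 h3] h4 h5] := leibniz_tripleP (semidirect rho).
split; first split.
- by move=> y z a u v; rewrite !semidirect_tripleE; apply: h1.
- by move=> y z a u v; rewrite !semidirect_tripleE; apply: h2.
- by move=> y z a u v; rewrite !semidirect_tripleE; apply: h3.
- by move=> a b c d e; rewrite !semidirect_tripleE; apply: h4.
- by move=> a b c d e; rewrite !semidirect_tripleE; apply: h5.
Qed.

Definition triple_rep : leibnizTripleRep (leibniz_triple A) W :=
  LeibnizTripleRep triple_repR_lin triple_repM_lin triple_repL_lin triple_repP.

End TripleRep.

Definition relative_rota_baxter (K : fieldType) (L V : lmodType K)
    (A : leibnizAlgebra L) (rho : leibnizRep A V) (T : {linear V -> L}) :=
  forall u v : V, A (T u) (T v) = T (rhol rho (T u) v + rhor rho (T v) u).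

Section RotaBaxter.
Context (K : fieldType) (L V : lmodType K).
Context (A : leibnizAlgebra L) (rho : leibnizRep A V).

Definition rb_br (T : {linear V -> L}) (u v : V) : V :=
  rhol rho (T u) v + rhor rho (T v) u.

Definition rb_rhol (T : {linear V -> L}) (u : V) (x : L) : L :=
  A (T u) x - T (rhor rho x u).

Definition rb_rhor (T : {linear V -> L}) (u : V) (x : L) : L :=
  A x (T u) - T (rhol rho x u).

Lemma rb_br_bilinear T : bilinear_for *:%R *:%R (rb_br T).
Proof.
by split=> x a u v; rewrite /rb_br /= ?(linearP T) ?linearPl ?linearPr
  ?(linearP T) scalerDr addrACA.
Qed.

Lemma rb_rhol_bilinear T : bilinear_for *:%R *:%R (rb_rhol T).
Proof.
by split=> x a u v; rewrite /rb_rhol /= ?(linearP T) ?linearPl ?linearPr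
  ?(linearP T) opprD scalerBr addrACA.
Qed.

Lemma rb_rhor_bilinear T : bilinear_for *:%R *:%R (rb_rhor T).
Proof.
by split=> x a u v; rewrite /rb_rhor /= ?(linearP T) ?linearPl ?linearPr
  ?(linearP T) opprD scalerBr addrACA.
Qed.

HB.instance Definition _ T :=
  bilinear_isBilinear.Build K V V V _ _ (rb_br T) (rb_br_bilinear T).
HB.instance Definition _ T :=
  bilinear_isBilinear.Build K V L L _ _ (rb_rhol T) (rb_rhol_bilinear T).
HB.instance Definition _ T :=
  bilinear_isBilinear.Build K V L L _ _ (rb_rhor T) (rb_rhor_bilinear T).

Context (T : {linear V -> L}) (rbT : relative_rota_baxter rho T).

Lemma rb_brT u v : T (rb_br T u v) = A (T u) (T v).
Proof. by rewrite rbT. Qed.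

Lemma rb_br_leibniz u v w :
  rb_br T u (rb_br T v w) =
  rb_br T (rb_br T u v) w - rb_br T (rb_br T u w) v.
Proof.
have E a b :
    semidirect_br rho (T a, a) (T b, b) = (T (rb_br T a b), rb_br T a b).
  by congr (_, _); rewrite rb_brT.
have := congr1 snd (semidirect_br_leibniz rho (T u, u) (T v, v) (T w, w)).
by rewrite !E.
Qed.

Lemma rb_rholB u y w :
  rb_rhol T u (y - T w) = A (T u) y - T (rhor rho y u + rhol rho (T u) w).
Proof.
rewrite /rb_rhol linearBr linearBl /=.
rewrite rbT !(linearD T) !(linearN T).
abel.
Qed.

Lemma rb_rhorB u y w :
  rb_rhor T u (y - T w) = A y (T u) - T (rhol rho y u + rhor rho (T u) w).
Proof.
rewrite /rb_rhor !linearBl /= rbT !(linearD T) !(linearN T).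
abel.
Qed.

Lemma rb_rhol_br u v x :
  rb_rhol T (rb_br T u v) x =
  rb_rhor T v (rb_rhol T u x) - rb_rhol T u (rb_rhor T v x).
Proof.
rewrite [rb_rhol T u x]/rb_rhol [rb_rhor T v x]/rb_rhor rb_rhorB rb_rholB.
rewrite /rb_rhol rb_brT /rb_br lbr_leibniz rhol_br' rhor_br.
rewrite !(linearD (rhor rho x)) !(linearD T) !(linearN T) /=.
abel.
Qed.

Lemma rb_rhol_br' u v x :
  rb_rhol T (rb_br T u v) x =
  rb_rhol T u (rb_rhol T v x) + rb_rhor T v (rb_rhol T u x).
Proof.
rewrite [rb_rhol T u x]/rb_rhol [rb_rhol T v x]/rb_rhol rb_rhorB rb_rholB.
rewrite /rb_rhol rb_brT /rb_br lbr_leibniz rhol_br rhor_br.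
rewrite !(linearD (rhor rho x)) !(linearD T) !(linearN T) /=.
abel.
Qed.

Lemma rb_rhor_br u v x :
  rb_rhor T (rb_br T u v) x =
  rb_rhor T v (rb_rhor T u x) - rb_rhor T u (rb_rhor T v x).
Proof.
rewrite [rb_rhor T u x]/rb_rhor [rb_rhor T v x]/rb_rhor !rb_rhorB.
rewrite /rb_rhor rb_brT /rb_br lbr_leibniz.
rewrite [rhol rho (A x (T u)) v]rhol_br' [rhol rho (A x (T v)) u]rhol_br.
rewrite !(linearD (rhol rho x)) !(linearD T) !(linearN T) /=.
abel.
Qed.

Definition rb_leibniz : leibnizAlgebra V :=
  @LeibnizAlgebra K V (rb_br T) rb_br_leibniz.

Definition rb_rep : leibnizRep rb_leibniz L :=
  @LeibnizRep K V rb_leibniz L (rb_rhol T) (rb_rhor T)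
    rb_rhol_br rb_rhol_br' rb_rhor_br.

End RotaBaxter.

(* Main.v *)
Require Import Defs.
From mathcomp Require Import all_boot all_order all_algebra.

Import GRing.Theory.
Local Open Scope ring_scope.

(** A 1-cocycle is a derivation for the bracket. Applying the derivation rule
    to [[u, v], w], and then to the inner [u, v], gives the term of [phi w]
    acted on by [u, v] and the images under the right action of [w] of the two
    terms of [phi [u, v]]: these are the [triple_L], [triple_M] and [triple_R]
    terms of the triple coboundary. This works for every representation; the
    one induced by a relative Rota-Baxter operator is an instance. *)
Lemma leibniz_cocycle1_triple (K : fieldType) (L W : lmodType K)
    (A : leibnizAlgebra L) (rho : leibnizRep A W) (phi : {linear L -> W}) :
  leibniz_cocycle1 rho phi -> triple_cocycle1 (triple_rep rho) phi.
Proof.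
move=> phi_cocycle u v w.
have phi_br x y : phi (A x y) = rhol rho x (phi y) + rhor rho y (phi x).
  by apply/esym/eqP; rewrite -subr_eq0 phi_cocycle.
rewrite /triple_coboundary1 /= /triple_R /triple_M /triple_L !phi_br linearDr.
by apply/eqP; rewrite subr_eq0 addrC [X in _ + X]addrC.
Qed.

Theorem theorem6p7 (K : fieldType) (L V : lmodType K) (A : leibnizAlgebra L)
    (rho : leibnizRep A V) (T : {linear V -> L})
    (rbT : relative_rota_baxter rho T) (phi : {linear V -> L}) :
  leibniz_cocycle1 (rb_rep rbT) phi ->
  triple_cocycle1 (triple_rep (rb_rep rbT)) phi.
Proof. exact: leibniz_cocycle1_triple. Qed.
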